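(* Let $G$ be a linear Lie group (i.e., a Lie group admitting a faithful continuous finite-dimensional linear representation). Suppose that there is an integer $n\ge 1$ such that every irreducible continuous finite-dimensional (not necessarily unitary) complex linear representation of $G$ has dimension at most $n$, and suppose that the family of all irreducible continuous finite-dimensional complex linear representations of $G$ separates the points of $G$ (i.e., for every $g\neq e$ in $G$ there is such a representation $\pi$ with $\pi(g)\neq \mathrm{id}$). Then $G$ is a finite extension of a commutative Lie group, i.e., $G$ contains a closed commutative normal subgroup $A$ such that the quotient $G/A$ is finite.
   Context: Representations are continuous homomorphisms $\pi\colon G\to GL(V)$ with $V$ a finite-dimensional complex vector space; they are not required to be unitary. A representation is irreducible if $V\neq 0$ has no proper nonzero $\pi(G)$-invariant subspace. *)

(* Defs.v *)
From mathcomp Require Import all_boot all_order all_algebra.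
From mathcomp Require Import all_classical all_reals all_analysis.
From mathcomp Require Import complex.
Import numFieldNormedType.Exports.

Set Implicit Arguments.
Unset Strict Implicit.
Unset Printing Implicit Defensive.

Local Open Scope classical_set_scope.
Local Open Scope ring_scope.

Definition Cplx (R : realType) : numFieldType := R[i].

Section Defs.
Variable (G : topologicalType) (mul : G -> G -> G) (inv : G -> G) (e : G).

Definition is_group : Prop :=
  [/\ (forall x y z, mul x (mul y z) = mul (mul x y) z),
      (forall x, mul e x = x /\ mul x e = x) &
      (forall x, mul (inv x) x = e /\ mul x (inv x) = e)].

Definition topological_group : Prop :=
  [/\ is_group,
      continuous (fun p : G * G => mul p.1 p.2) &
      continuous inv].

Definition locally_euclidean (R : realType) : Prop :=
  forall x : G, exists (d : nat) (U : set G) (phi : G -> 'rV[R]_d)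
                       (psi : 'rV[R]_d -> G),
    [/\ open U, U x & open (phi @` U)] /\
    [/\ (forall y, U y -> psi (phi y) = y),
        {within U, continuous phi} &
        {within phi @` U, continuous psi}].

Definition lie_group (R : realType) : Prop :=
  [/\ hausdorff_space G, topological_group & locally_euclidean R].

(* continuous finite-dimensional complex representation on C^k
   (matrices act on column vectors) *)
Definition cont_rep (R : realType) (k : nat) (pi : G -> 'M[Cplx R]_k) : Prop :=
  [/\ pi e = 1%:M,
      (forall g h, pi (mul g h) = pi g *m pi h),
      (forall g, pi g \in unitmx) &
      continuous pi].

(* irreducible: V = C^k <> 0 and the only pi(G)-invariant subspaces are 0 and V.
   A subspace is the row space of W; its column vectors are the transposed
   rows, so invariance under pi g is stablemx W (pi g)^T. *)
Definition irreducible_rep (R : realType) (k : nat) (pi : G -> 'M[Cplx R]_k)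
  : Prop :=
  (0 < k)%N /\
  forall W : 'M[Cplx R]_k,
    (forall g, stablemx W (pi g)^T) -> \rank W = 0%N \/ \rank W = k.

Definition linear_lie_group (R : realType) : Prop :=
  lie_group R /\
  exists (k : nat) (pi : G -> 'M[Cplx R]_k), cont_rep pi /\ injective pi.

Definition is_subgroup (A : set G) : Prop :=
  [/\ A e, (forall a b, A a -> A b -> A (mul a b)) & (forall a, A a -> A (inv a))].

Definition is_normal (A : set G) : Prop :=
  forall g a, A a -> A (mul (mul g a) (inv g)).

Definition is_commutative (A : set G) : Prop :=
  forall a b, A a -> A b -> mul a b = mul b a.

Definition finite_index (A : set G) : Prop :=
  exists (N : nat) (s : nat -> G),
    forall g, exists i, (i < N)%N /\ A (mul (inv (s i)) g).

End Defs.

(* Main.v *)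
(** If every irreducible representation has dimension at most n, then for
    N = n^2+1 the alternating sum of the products g_s = g_(s 1) ... g_(s N) over
    the permutations s vanishes in every irreducible representation, hence is
    traceless in every representation.  Characters are closed under products, so
    evaluating a suitable polynomial in characters on this alternating sum
    yields, for all g_i and h and finitely many characters, some s <> 1 such that
    g_s h and g_1 h have equal character values.

    For a homomorphism rho into matrices, the sets {g | tr (B rho g) = 0}
    generate a Noetherian topology on G, in which translations are continuous;
    the union of the irreducible sets containing e is a normal subgroup of finite
    index, the substitute for the identity component of the Zariski closure.  On
    it the permutation s above can be chosen independently of the g_i, and taking
    all but two of them trivial turns trace identities into commutation.  Hence,
    for pi irreducible, pi maps its component to commuting matrices, and an element
    u of it with tr pi(u h) = tr pi(h) for all h in it acts trivially.  Since irreducible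
    representations separate points, it follows that for all g_i there is s <> 1
    with g_s = g_1 in G itself.  The same argument applied to a faithful
    representation then shows that its component is commutative; its double
    centralizer is the required subgroup. *)
Require Import Defs.
From mathcomp Require Import all_boot all_order all_algebra.
From mathcomp Require Import all_classical all_reals all_analysis.
From mathcomp Require Import fingroup perm complex mxtens.
Import Order.TTheory GRing.Theory Num.Theory.
Import numFieldNormedType.Exports.
Set Implicit Arguments.
Unset Strict Implicit.
Unset Printing Implicit Defensive.
Local Open Scope classical_set_scope.
Local Open Scope ring_scope.

(** * Matrices *)

(* Expanding in matrix units, the coefficient of each product of units is a
   determinant with two equal rows, since N > k^2. *)
Lemma standard_identity (K : fieldType) (k N : nat)
  (X : 'I_N -> 'M[K]_k) : (k * k < N)%N ->
  \sum_(s : 'S_N) (-1) ^+ s *: \prod_(i < N) X (s i) = 0.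
Proof.
case: k X => [|k] X ltN; first by apply/matrixP => -[].
have XE A : A = \sum_(q : 'I_k.+1 * 'I_k.+1) A q.1 q.2 *: delta_mx q.1 q.2 :> 'M[K]_k.+1.
  by rewrite {1}[A]matrix_sum_delta pair_bigA.
transitivity (\sum_(s : 'S_N) \sum_(f : {ffun 'I_N -> 'I_k.+1 * 'I_k.+1})
   ((-1) ^+ s * \prod_i X (s i) (f i).1 (f i).2) *:
      \prod_(i < N) (delta_mx (f i).1 (f i).2 : 'M[K]_k.+1)).
  apply: eq_bigr => s _.
  under eq_bigr => i _ do rewrite (XE (X (s i))).
  rewrite bigA_distr_bigA scaler_sumr; apply: eq_bigr => f _.
  by rewrite scaler_prod scalerA.
rewrite exchange_big big1 // => f _; rewrite -scaler_suml.
suff -> : \sum_(s : 'S_N) (-1) ^+ s * \prod_i X (s i) (f i).1 (f i).2 = 0.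
  by rewrite scale0r.
pose A := \matrix_(i < N, j < N) X j (f i).1 (f i).2.
transitivity (\det A).
  by apply: eq_bigr => s _; congr (_ * _); apply: eq_bigr => i _; rewrite mxE.
have /injectivePn [i [j neq_ij eq_f]] : ~~ injectiveb f.
  apply/negP => /injectiveP /leq_card; rewrite card_prod !card_ord leqNgt ltN.
  by [].
by apply: (determinant_alternate neq_ij) => l; rewrite !mxE eq_f.
Qed.

Lemma idem_factor (K : fieldType) n (E : 'M[K]_n) : E *m E = E ->
  exists (A : 'M[K]_(n, \rank E)) (B : 'M[K]_(\rank E, n)),
    A *m B = E /\ B *m A = 1%:M.
Proof.
move=> EE; exists (col_base E), (row_base E).
have /row_freeP := row_base_free E; have /row_fullP := col_base_full E.
have := mulmx_base E.
move: (row_base E) (col_base E); move: (\rank E) => r B A AB [A' AA'] [B' BB'].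
split=> //.
have : A' *m (E *m E) *m B' = A' *m E *m B' by rewrite EE.
by rewrite -AB !mulmxA AA' !mul1mx -!mulmxA BB' mulmx1.
Qed.

Lemma idem_trace (K : fieldType) n (E : 'M[K]_n) :
  E *m E = E -> \tr E = (\rank E)%:R.
Proof.
move=> /idem_factor [A [B [AB BA]]].
by rewrite -{1}AB mxtrace_mulC BA mxtrace1.
Qed.

(** The projection onto the part where [A] is invertible is a polynomial in [A] without constant
    term, so its trace vanishes. In characteristic zero this trace is its rank, so the projection is
    zero. *)
Lemma nilpotent_of_traces (K : numFieldType) n (A : 'M[K]_n.+1) :
  (forall k, \tr (A ^+ k.+1) = 0) -> exists m, A ^+ m = 0.
Proof.
move=> trA.
have p0 : mxminpoly A != 0 by apply: monic_neq0; apply: mxminpoly_monic.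
have [m [q]] := multiplicity_XsubC (mxminpoly A) 0.
rewrite p0 /= subr0 => nq0 pE.
(* The exponent [m.+1] makes every power of [A] in the idempotent [e] below positive, also if
   [m = 0]. *)
have /Bezout_eq1_coprimepP [[u v] /= uv] : coprimep ('X^(m.+1) : {poly K}) q.
  apply: coprimep_expl; rewrite -[X in coprimep X _]subr0 -polyC0.
  by rewrite coprimep_sym coprimep_XsubC.
have qA : horner_mx A q *m A ^+ m.+1 = 0.
  rewrite exprSr mulmxA.
  suff -> : horner_mx A q *m A ^+ m = 0 by rewrite mul0mx.
  have := mx_root_minpoly A; rewrite pE rmorphM rmorphXn /= horner_mx_X.
  by [].
have uvA : horner_mx A u *m A ^+ m.+1 + horner_mx A v *m horner_mx A q = 1%:M.
  have := congr1 (horner_mx A) uv.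
  by rewrite rmorphD !rmorphM rmorphXn /= horner_mx_X rmorph1.
set e := horner_mx A u *m A ^+ m.+1 in uvA.
have ee : e *m e = e.
  rewrite -[RHS]mulmx1 -uvA mulmxDr.
  suff -> : e *m (horner_mx A v *m horner_mx A q) = 0 by rewrite addr0.
  have -> : e = horner_mx A ('X^(m.+1) * u).
    by rewrite mulrC rmorphM rmorphXn /= horner_mx_X.
  have -> : horner_mx A v *m horner_mx A q = horner_mx A (q * v).
    by rewrite mulrC rmorphM.
  rewrite -[_ *m _]/(_ * _) -rmorphM -mulrA mulrC -mulrA.
  have -> : u * (q * v * 'X^(m.+1)) = u * v * (q * 'X^(m.+1)).
    by rewrite [q * v]mulrC !mulrA.
  rewrite rmorphM [X in _ * X]rmorphM rmorphXn /= horner_mx_X.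
  by rewrite -[X in _ * X]/(_ *m _) qA mulr0.
have te : \tr e = 0.
  rewrite /e -[u]coefK poly_def rmorph_sum /= mulmx_suml raddf_sum /= big1 // => i _.
  rewrite linearZ /= rmorphXn /= horner_mx_X -scalemxAl linearZ /=.
  by rewrite -[_ *m _]/(_ * _) -exprD addnS trA mulr0.
have e0 : e = 0.
  apply/eqP; rewrite -mxrank_eq0 -(pnatr_eq0 K); rewrite -idem_trace // te.
  by [].
exists m.+1.
move: uvA; rewrite e0 add0r => vq.
rewrite -[A ^+ m.+1]mul1mx -vq -mulmxA qA; exact: mulmx0.
Qed.

(** A finite subfamily of maximal rank spans, since adjoining a further [f i] cannot raise the
    rank. *)
Lemma span_fin (K : fieldType) (I : Type) D (f : I -> 'rV[K]_D) :
  exists m (s : 'I_m -> I), forall i, (f i <= \matrix_j f (s j))%MS.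
Proof.
have [m [s sP]] : exists m (s : 'I_m -> I), forall m' (s' : 'I_m' -> I),
   (\rank (\matrix_j f (s' j)) <= \rank (\matrix_j f (s j)))%N.
  pose P r := `[< exists m (s : 'I_m -> I), \rank (\matrix_j f (s j)) = r >].
  have P0 : exists r, P r.
    by exists (\rank (\matrix_(j < 0) (0 : 'rV[K]_D))); apply/asboolP; exists 0%N;
       exists (fun j : 'I_0 => match notF (ltn_ord j) with end);
       congr mxrank; apply/matrixP => -[].
  have Pb r : P r -> (r <= D)%N by move=> /asboolP [m [s <-]]; apply: rank_leq_col.
  case: (ex_maxnP P0 Pb) => r /asboolP [m [s <-]] max.
  by exists m, s => m' s'; apply: max; apply/asboolP; exists m', s'.
exists m, s => i.
pose s' (j : 'I_m.+1) := if unlift ord0 j is Some j' then s j' else i.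
have sub : (\matrix_j f (s j) <= \matrix_j f (s' j))%MS.
  apply/row_subP => j; rewrite rowK.
  have -> : f (s j) = row (lift ord0 j) (\matrix_j f (s' j)) by rewrite rowK /s' liftK.
  exact: row_sub.
have : (\matrix_j f (s' j) <= \matrix_j f (s j))%MS.
  by have := mxrank_leqif_sup sub => /geq_leqif <-.
apply: submx_trans.
have -> : f i = row ord0 (\matrix_j f (s' j)) by rewrite rowK /s' unlift_none.
exact: row_sub.
Qed.

(** Among the nonzero row spaces stable under [P] take [W] of minimal rank. By commutation [W *m X]
    is stable too, so it is zero or all of [W]; the latter contradicts nilpotency of [X]. *)
Lemma commuting_nilpotents_kernel (K : fieldType) n (P : set 'M[K]_n.+1) :
  (forall X Y, P X -> P Y -> X *m Y = Y *m X) ->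
  (forall X, P X -> exists m, X ^+ m = 0) ->
  exists2 W : 'M[K]_n.+1, W != 0 & forall X, P X -> W *m X = 0.
Proof.
move=> comm nil.
pose Q r := `[< exists W : 'M[K]_n.+1,
  [/\ \rank W = r, (0 < r)%N & forall X, P X -> (W *m X <= W)%MS] >].
have exQ : exists r, Q r.
  exists n.+1; apply/asboolP; exists 1%:M; split=> // [|X _].
    by rewrite mxrank1.
  exact: submx1.
case: (ex_minnP exQ) => r /asboolP [W [Wr r_gt0 Wst]] min.
exists W => [|X PX]; first by rewrite -mxrank_eq0 Wr -lt0n.
apply/eqP; rewrite -mxrank_eq0; apply/negPn/negP => WX0.
have : (r <= \rank (W *m X))%N.
  apply: min; apply/asboolP; exists (W *m X); split=> // [|Y PY].
    by rewrite lt0n.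
  by rewrite -mulmxA (comm X Y) // mulmxA submxMr // Wst.
rewrite -Wr; have := mxrank_leqif_sup (Wst X PX) => /geq_leqif -> WX.
have [m Xm] := nil X PX.
have : (W <= W *m X ^+ m)%MS.
  elim: m {Xm} => [|m IHm]; first by rewrite expr0 mulmx1.
  by apply: (submx_trans WX); rewrite exprSr mulmxA submxMr.
by rewrite Xm mulmx0 submx0 -mxrank_eq0 Wr eqn0Ngt r_gt0.
Qed.

Lemma mxpowSr (K : pzRingType) n (X : 'M[K]_n) i : X ^+ i.+1 = X ^+ i *m X.
Proof. exact: exprSr. Qed.

(** * Matrix representations and irreducibility *)

Section Rep.
Variables (R : realType) (G : topologicalType).
Variables (mul : G -> G -> G) (inv : G -> G) (e : G).
Hypothesis HG : is_group mul inv e.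
Local Notation K := (Cplx R).
Local Notation "x ** y" := (mul x y) (at level 40, left associativity).

Lemma gmulA x y z : x ** (y ** z) = x ** y ** z. Proof. by case: HG. Qed.
Lemma gmul1 x : e ** x = x. Proof. by case: HG => _ /(_ x) []. Qed.
Lemma gmulr1 x : x ** e = x. Proof. by case: HG => _ /(_ x) []. Qed.
Lemma gmulV x : inv x ** x = e. Proof. by case: HG => _ _ /(_ x) []. Qed.
Lemma gmulrV x : x ** inv x = e. Proof. by case: HG => _ _ /(_ x) []. Qed.
Lemma gmulK x y : inv x ** (x ** y) = y. Proof. by rewrite gmulA gmulV gmul1. Qed.
Lemma gmulVK x y : x ** (inv x ** y) = y. Proof. by rewrite gmulA gmulrV gmul1. Qed.
Lemma gmulrK x y : y ** x ** inv x = y. Proof. by rewrite -gmulA gmulrV gmulr1. Qed.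
Lemma gmulrVK x y : y ** inv x ** x = y. Proof. by rewrite -gmulA gmulV gmulr1. Qed.
Lemma ginvK x : inv (inv x) = x.
Proof. by rewrite -[LHS]gmulr1 -(gmulV x) gmulA gmulV gmul1. Qed.

Definition mx_hom k (pi : G -> 'M[K]_k) :=
  pi e = 1%:M /\ forall g h, pi (g ** h) = pi g *m pi h.

Lemma cont_rep_hom k (pi : G -> 'M[K]_k) : cont_rep mul e pi -> mx_hom pi.
Proof. by case. Qed.

(* Membership in the linear span of pi @` S, as a double annihilator for the
   trace form. *)
Definition in_span k (pi : G -> 'M[K]_k) (S : set G) (X : 'M[K]_k) :=
  forall B, (forall g, S g -> \tr (B *m pi g) = 0) -> \tr (B *m X) = 0.

Section Hom.
Variables (k : nat) (pi : G -> 'M[K]_k).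
Hypothesis hpi : mx_hom pi.

Lemma hom1 : pi e = 1%:M. Proof. by case: hpi. Qed.
Lemma homM g h : pi (g ** h) = pi g *m pi h. Proof. by case: hpi. Qed.
Lemma homV g : pi g *m pi (inv g) = 1%:M.
Proof. by rewrite -homM gmulrV hom1. Qed.
Lemma homVl g : pi (inv g) *m pi g = 1%:M.
Proof. by rewrite -homM gmulV hom1. Qed.

Lemma in_spanE S g : S g -> in_span pi S (pi g).
Proof. by move=> Sg B; apply. Qed.

Lemma in_span_lin S a X Y :
  in_span pi S X -> in_span pi S Y -> in_span pi S (a *: X + Y).
Proof.
move=> SX SY B BS.
by rewrite mulmxDr -scalemxAr mxtraceD mxtraceZ SX // SY // mulr0 addr0.
Qed.

Lemma in_span0 S : in_span pi S 0.
Proof. by move=> B _; rewrite mulmx0 raddf0. Qed.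

Lemma in_spanB S X Y :
  in_span pi S X -> in_span pi S Y -> in_span pi S (X - Y).
Proof. by move=> SX SY; rewrite addrC -scaleN1r; apply: in_span_lin. Qed.

(** One factor is treated at a time: the trace is cyclic, so the other factor can be absorbed into
    the test matrix. *)
Lemma in_spanM (S : set G) X Y : (forall g h, S g -> S h -> S (g ** h)) ->
  in_span pi S X -> in_span pi S Y -> in_span pi S (X *m Y).
Proof.
move=> SM SX SY B BS; rewrite mulmxA; apply: SY => h Sh.
rewrite mxtrace_mulC mulmxA.
apply: SX => g Sg.
by rewrite -mulmxA mxtrace_mulC -mulmxA -homM BS //; apply: SM.
Qed.
End Hom.

(* If c <> 0, irreducibility gives a in the span of pi with a c fixing a nonzero
   vector, while the traces of the powers of a c vanish, so a c is nilpotent. *)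
Lemma irreducible_trace_nondegenerate k (pi : G -> 'M[K]_k) c :
  mx_hom pi -> irreducible_rep pi -> in_span pi setT c ->
  (forall g, \tr (c *m pi g) = 0) -> c = 0.
Proof.
move=> hpi [k0 irr] cA tr0.
apply/eqP/negPn/negP => c0.
have [v vc0] : exists v : 'rV[K]_k, v *m c^T != 0.
  have : c^T != 0 by rewrite -[0]trmx0 (inj_eq trmx_inj).
  by case/rowV0Pn => w /submxP [v ->] w0; exists v.
pose w := v *m c^T.
(* [M] spans the orbit of [w]; by irreducibility this is the whole space, so [v] is a combination of
   translates of [w]. *)
have [m [s sP]] := span_fin (fun g => w *m (pi g)^T).
set M := \matrix_j _ in sP.
have Mst g : stablemx << M >>%MS (pi g)^T.
  rewrite (eqmxMr _ (genmxE M)) genmxE; apply/row_subP => j.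
  by rewrite row_mul rowK -mulmxA -trmx_mul -(homM hpi) sP.
have wM : (w <= M)%MS by have := sP e; rewrite (hom1 hpi) trmx1 mulmx1.
have [|fullM] := irr _ Mst.
  rewrite mxrank_gen => /eqP; rewrite mxrank_eq0 => /eqP M0.
  by move: wM vc0; rewrite M0 -/w => /submx0null w0; rewrite w0 eqxx.
have /submxP [y vE] : (v <= M)%MS.
  by rewrite submx_full // /row_full -(mxrank_gen M); apply/eqP.
pose a := \sum_j y 0 j *: pi (s j).
have aA : in_span pi setT a.
  rewrite /a; elim/big_ind: _ => [|X Y AX AY|j _]; first exact: in_span0.
    by rewrite -[X]scale1r; apply: in_span_lin.
  by rewrite -[_ *: _]addr0; apply: in_span_lin; [exact: in_spanE|exact: in_span0].
have vac : v *m (a *m c)^T = v.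
  have aT : a^T = \sum_j y 0 j *: (pi (s j))^T.
    by rewrite /a raddf_sum; apply: eq_bigr => j _; exact: linearZ.
  rewrite trmx_mul mulmxA -/w [RHS]vE [RHS]mulmx_sum_row aT mulmx_sumr.
  by apply: eq_bigr => j _; rewrite rowK -scalemxAr.
case: k k0 => // k' _ in pi c hpi irr cA tr0 c0 v vc0 w m s M sP Mst wM fullM y vE a aA vac *.
have [n acn] : exists n, (a *m c) ^+ n = 0.
  apply: nilpotent_of_traces => i.
  rewrite mxpowSr mulmxA mxtrace_mulC.
  (* Trace orthogonality to [c] extends from the image of [pi] to its span, which is closed under
     products. *)
  suff acA : in_span pi setT ((a *m c) ^+ i *m a) by apply: acA.
  elim: i => [|i IHi]; first by rewrite expr0 mul1mx.
  rewrite exprS -[_ * _]/(_ *m _) -mulmxA.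
  by do 2?[apply: in_spanM => //].
have : v *m ((a *m c) ^+ n)^T = v.
  elim: n {acn} => [|n IHn]; first by rewrite expr0 trmx1 mulmx1.
  by rewrite mxpowSr trmx_mul mulmxA vac.
rewrite acn trmx0 mulmx0 => v0.
by move: vc0; rewrite -v0 mul0mx eqxx.
Qed.

(* The hypothesis makes pi u unipotent, and the common kernel of the commuting
   nilpotents pi h - 1, for h in H with pi h unipotent, is G-stable. *)
Lemma unipotent_trivial k (pi : G -> 'M[K]_k) (H : set G) u :
  mx_hom pi -> irreducible_rep pi ->
  is_subgroup mul inv e H -> is_normal mul inv H ->
  (forall x y, H x -> H y -> pi (x ** y) = pi (y ** x)) ->
  H u -> (forall h, H h -> \tr ((pi u - 1%:M) *m pi h) = 0) -> pi u = 1%:M.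
Proof.
move=> hpi [k0 irr] [H1 HM HV] nH cH Hu tr0.
case: k k0 => // k' _ in pi hpi irr cH tr0 *.
have [m um] : exists m, (pi u - 1%:M) ^+ m = 0.
  apply: nilpotent_of_traces => i.
  rewrite exprS -[_ * _]/(_ *m _).
  have aA : in_span pi H (pi u - 1%:M).
    by apply: in_spanB; rewrite -?(hom1 hpi); apply: in_spanE.
  suff acA : in_span pi H ((pi u - 1%:M) ^+ i) by apply: acA.
  elim: i => [|i IHi]; first by rewrite expr0 -[1]/(1%:M) -(hom1 hpi); apply: in_spanE.
  by rewrite exprS; apply: in_spanM.
(* Transposes appear because invariant subspaces are row spaces, on which [pi g] acts by its
   transpose. *)
pose P (X : 'M[K]_k'.+1) := exists2 h, H h & X = (pi h)^T - 1%:M /\ exists m, X ^+ m = 0.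
have Pcomm X Y : P X -> P Y -> X *m Y = Y *m X.
  move=> [g Hg [-> _]] [h Hh [-> _]].
  rewrite !mulmxBl !mulmxBr !mulmx1 !mul1mx -!trmx_mul -!(homM hpi) cH //.
  rewrite !opprB -!addrA; congr (_ + _).
  by rewrite addrCA [RHS]addrCA [- _ - _]addrC.
have Pnil X : P X -> exists m, X ^+ m = 0 by case=> g _ [].
have Pconj X g : P X -> exists2 Y, P Y & (pi g)^T *m X = Y *m (pi g)^T.
  move=> [h Hh [-> [m' Xm]]].
  have gXY : (pi g)^T *m ((pi h)^T - 1%:M) =
      ((pi (inv g ** h ** g))^T - 1%:M) *m (pi g)^T.
    rewrite mulmxBl mulmxBr mulmx1 mul1mx -!trmx_mul -!(homM hpi).
    by rewrite !gmulA gmulrV gmul1.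
  exists ((pi (inv g ** h ** g))^T - 1%:M) => //.
  exists (inv g ** h ** g); last split=> //.
    by have := nH (inv g) h Hh; rewrite ginvK.
  exists m'; have : (pi g)^T *m ((pi h)^T - 1%:M) ^+ m' =
      ((pi (inv g ** h ** g))^T - 1%:M) ^+ m' *m (pi g)^T.
    elim: m' {Xm} => [|i IHi]; first by rewrite !expr0 mulmx1 mul1mx.
    by rewrite !mxpowSr mulmxA IHi -mulmxA gXY mulmxA.
  rewrite Xm mulmx0 => /esym /(congr1 (mulmx^~ (pi (inv g))^T)).
  by rewrite mul0mx -mulmxA -trmx_mul homVl // trmx1 mulmx1.
(* A matrix of maximal rank killed by [P] has the common kernel of [P] as its row space. Conjugation
   by [g] preserves [P], as [H] is normal, so this kernel is stable under G. *)
pose Q r := `[< exists W : 'M[K]_k'.+1, \rank W = r /\ forall X, P X -> W *m X = 0 >].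
have exQ : exists r, Q r.
  have [W _ WP] := commuting_nilpotents_kernel Pcomm Pnil.
  by exists (\rank W); apply/asboolP; exists W.
have Qb r : Q r -> (r <= k'.+1)%N by move=> /asboolP [W [<- _]]; apply: rank_leq_col.
case: (ex_maxnP exQ Qb) => r /asboolP [W [Wr WP]] max.
have [||rk] := irr W.
- move=> g; have WW : (W <= W + W *m (pi g)^T)%MS by exact: addsmxSl.
  suff : (W + W *m (pi g)^T <= W)%MS.
    by apply: submx_trans; exact: addsmxSr.
  have := mxrank_leqif_sup WW => /geq_leqif <-; rewrite Wr; apply: max.
  apply/asboolP; exists (W + W *m (pi g)^T)%MS; split=> // X PX.
  have [Y PY gXY] := Pconj X g PX.
  apply/eqP; rewrite -submx0 addsmxMr addsmx_sub -mulmxA gXY mulmxA !WP //.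
  by rewrite mul0mx submx_refl.
- move=> rk0; have [W' W'0 W'P] := commuting_nilpotents_kernel Pcomm Pnil.
  have := max (\rank W'); rewrite -Wr rk0 leqn0 mxrank_eq0 (negPf W'0).
  by move=> F; have /F : Q (\rank W') by apply/asboolP; exists W'.
have : W *m ((pi u)^T - 1%:M) = 0.
  apply: WP; exists u => //; split=> //; exists m.
  rewrite -[X in _ - X]trmx1 -raddfB /= -[RHS]trmx0 -um.
  elim: m {um} => [|i IHi]; first by rewrite !expr0 [RHS]trmx1.
  by rewrite exprS mxpowSr trmx_mul IHi.
have /row_fullP [W' W'W] : row_full W by rewrite /row_full rk.
move=> /(congr1 (mulmx W')); rewrite mulmxA W'W mul1mx mulmx0 => /eqP.
by rewrite subr_eq0 => /eqP; rewrite -[X in _ = X]trmx1 => /trmx_inj.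
Qed.
End Rep.

(** * Trace functionals, ordered products and permutations *)

Lemma mxtrace_functional (K : fieldType) n (B : 'M[K]_n) :
  exists b : 'cV[K]_(n * n), forall X, \tr (B *m X) = (mxvec X *m b) 0 0.
Proof.
exists (mxvec B^T)^T => X; rewrite mxE (reindex _ (curry_mxvec_bij _ _)) /=.
rewrite (eq_bigr (fun p : 'I_n * 'I_n => X p.1 p.2 * B p.2 p.1)); last first.
  by case=> i j _ /=; rewrite mxvecE [X in _ * X]mxE mxvecE mxE.
rewrite -(pair_bigA _ (fun i j => X i j * B j i)) exchange_big /=.
by apply: eq_bigr => i _; rewrite mxE; apply: eq_bigr => j _; rewrite mulrC.
Qed.

Lemma prod_mx_insert (K : fieldType) n (I : eqType) (r : seq I) j0
  (F : I -> 'M[K]_n) : uniq r -> j0 \in r ->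
  exists L U : 'M[K]_n, forall X,
    \prod_(j <- r) (if j == j0 then X else F j) = L *m X *m U.
Proof.
move=> ur j0r; case/splitPr: j0r ur => r1 r2; rewrite cat_uniq /= negb_or.
move=> /and3P [_ /andP [nr1 _] /andP [nr2 _]].
exists (\prod_(j <- r1) F j), (\prod_(j <- r2) F j) => X.
rewrite big_cat big_cons eqxx -[LHS]/(_ *m (_ *m _)) mulmxA; congr (_ *m _ *m _).
  by apply: eq_big_seq => j jr; case: eqP => // jj; rewrite -jj jr in nr1.
by apply: eq_big_seq => j jr; case: eqP => // jj; rewrite -jj jr in nr2.
Qed.

Lemma prod_mx_two (K : fieldType) n N (F : 'I_N -> 'M[K]_n) (a b : 'I_N) :
  (a < b)%N -> (forall j, j != a -> j != b -> F j = 1) ->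
  \prod_(j < N) F j = F a *m F b.
Proof.
move=> ab F1.
transitivity (\prod_(j <- index_enum 'I_N | (j == a) || (j == b)) F j).
  rewrite [RHS]big_mkcond; apply: eq_bigr => j _.
  by case: ifPn => //; rewrite negb_or => /andP [ja jb]; apply: F1.
rewrite -big_filter.
suff -> : [seq j <- index_enum 'I_N | (j == a) || (j == b)] = [:: a; b].
  by rewrite !big_cons big_nil mulr1.
have ltn_tr : transitive (fun i j : 'I_N => (i < j)%N).
  by move=> i j k; apply: ltn_trans.
apply: (irr_sorted_eq ltn_tr) => [i||/=|j]; first exact: ltnn.
- apply: (sorted_filter ltn_tr); rewrite /index_enum unlock -enumT.
  by have := iota_ltn_sorted 0 N; rewrite -val_enum_ord sorted_map.
- by rewrite ab.
- by rewrite mem_filter mem_index_enum andbT !inE.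
Qed.

Definition upd (I : eqType) (T : Type) (g : I -> T) i x :=
  fun j => if j == i then x else g j.

(** Without inversions [s] is increasing, so it maps the sorted enumeration of the indices to a
    sorted enumeration, which is unique. *)
Lemma perm_inversion N (s : 'S_N) : s != 1%g ->
  exists a b : 'I_N, (a < b)%N /\ (s b < s a)%N.
Proof.
move=> s1; apply: contrapT => H.
have mono (a b : 'I_N) : (a < b)%N -> (s a < s b)%N.
  move=> ab; rewrite ltn_neqAle; apply/andP; split.
    by apply: contraTneq ab => /val_inj /perm_inj ->; rewrite ltnn.
  by rewrite leqNgt; apply/negP => ba; apply: H; exists a, b.
move/eqP: s1; apply; apply/permP => i; rewrite perm1.
have ltn_tr : transitive (fun i j : 'I_N => (i < j)%N).
  by move=> x y z; apply: ltn_trans.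
have se : sorted (fun i j : 'I_N => (i < j)%N) (enum 'I_N).
  by have := iota_ltn_sorted 0 N; rewrite -val_enum_ord sorted_map.
have eq_enum : [seq s i | i <- enum 'I_N] = enum 'I_N.
  apply: (irr_sorted_eq ltn_tr) => [j|//||j].
  - exact: ltnn.
  - rewrite sorted_map; apply: sub_sorted se => x y; exact: mono.
  - exact: se.
  - rewrite mem_enum; apply/mapP; exists ((s^-1)%g j); rewrite ?mem_enum //.
    by rewrite permKV.
have := congr1 (fun t => nth i t i) eq_enum.
by rewrite (nth_map i) ?size_enum_ord // !nth_ord_enum.
Qed.

(** * The linear component of the identity *)

Section Component.
Variables (R : realType) (G : topologicalType).
Variables (mul : G -> G -> G) (inv : G -> G) (e : G).
Hypothesis HG : is_group mul inv e.
Local Notation K := (Cplx R).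
Local Notation "x ** y" := (mul x y) (at level 40, left associativity).
Variables (D : nat) (rho : G -> 'M[K]_D).
Hypothesis hrho : mx_hom mul e rho.
Let rhoM := homM hrho.

(** The subbasic closed sets: zero sets on G of linear forms in the entries of [rho]. *)
Definition vanish (B : 'M[K]_D) : set G := [set g | \tr (B *m rho g) = 0].

(* Intersections of sets [vanish B]. *)
Definition lin_closed (C : set G) :=
  forall g, ~ C g -> exists2 B, ~ vanish B g & C `<=` vanish B.

(** Topological irreducibility, tested on finite covers by subbasic closed sets; the empty cover
    forces [A] to be nonempty. *)
Definition lin_irr (A : set G) := forall I : seq 'M[K]_D,
  (forall g, A g -> exists2 B, B \in I & vanish B g) ->
  exists2 B, B \in I & A `<=` vanish B.

Lemma lin_irr_nonempty A : lin_irr A -> exists g, A g.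
Proof.
move=> irrA; apply: contrapT => nA.
by have [|B] := irrA [::] => // g Ag; case: nA; exists g.
Qed.

(** If [A] lies in no [C j], each [C j] can be enlarged to some [vanish B] still not containing [A],
    and these finitely many sets contradict irreducibility. *)
Lemma lin_irr_closed A (J : eqType) (s : seq J) (C : J -> set G) : lin_irr A ->
  (forall j, j \in s -> lin_closed (C j)) ->
  (forall g, A g -> exists2 j, j \in s & C j g) ->
  exists2 j, j \in s & A `<=` C j.
Proof.
move=> irrA clC cov; apply: contrapT => H.
have /choice [B BP] : forall j, exists B, j \in s ->
    ~ (A `<=` vanish B) /\ C j `<=` vanish B.
  move=> j; have [js|] := boolP (j \in s); last by exists 0.
  have [g Ag nCg] : exists2 g, A g & ~ C j g.
    apply: contrapT => nex; apply: H; exists j => // g Ag.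
    by apply: contrapT => nC; apply: nex; exists g.
  have [B nB CB] := clC j js g nCg.
  by exists B => _; split=> // AB; apply: nB; apply: AB.
have [g Ag|B' /mapP [j js ->] AB] := irrA [seq B j | j <- s].
- have [j js Cj] := cov g Ag; exists (B j); first exact: map_f.
  by have [_] := BP j js; apply.
- by have [nA _] := BP j js; apply: nA.
Qed.

(** The condition on [f] expresses continuity: preimages of subbasic closed sets are again such
    sets. *)
Lemma lin_irr_image A (f : G -> G) : lin_irr A ->
  (forall B, exists B', forall g, \tr (B *m rho (f g)) = \tr (B' *m rho g)) ->
  lin_irr (f @` A).
Proof.
move=> irrA /choice [F FP] I cov.
have [g Ag|B' /mapP [B BI ->] AB] := irrA [seq F B | B <- I].
  have [|B BI] := cov (f g); first by exists g.
  by rewrite /vanish /= FP => BF; exists (F B); first exact: map_f.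
by exists B => // _ [g Ag <-]; rewrite /vanish /= FP; apply: AB.
Qed.

Lemma lin_irr_shift A a b : lin_irr A -> lin_irr ((fun g => a ** g ** b) @` A).
Proof.
move=> irrA; apply: lin_irr_image => // B; exists (rho b *m B *m rho a) => g.
by rewrite !rhoM mulmxA mxtrace_mulC !mulmxA.
Qed.

(* Only separate continuity of the multiplication is needed. *)
Lemma lin_irr_mul A A' : lin_irr A -> lin_irr A' ->
  lin_irr [set x | exists a b, [/\ A a, A' b & x = a ** b]].
Proof.
move=> irrA irrA' I cov.
(* For each [a], irreducibility of [A'] puts its translate by [a] inside one [vanish B].
   Irreducibility of [A] then makes [B] independent of [a], the set of suitable [a] being an
   intersection of subbasic closed sets. *)
have [j jI|a Aa|B BI AB] := lin_irr_closed (s := I)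
    (C := fun B => [set a | forall b, A' b -> vanish B (a ** b)]) irrA.
- move=> a /= nC; have [b A'b nB] : exists2 b, A' b & ~ vanish j (a ** b).
    apply: contrapT => nex; apply: nC => b A'b.
    by apply: contrapT => nC; apply: nex; exists b.
  have E x : \tr (j *m rho (x ** b)) = \tr ((rho b *m j) *m rho x).
    by rewrite rhoM mulmxA mxtrace_mulC mulmxA.
  exists (rho b *m j); first by rewrite /vanish /= -E.
  by move=> x /(_ b A'b); rewrite /vanish /= E.
- have E B x : \tr (B *m rho (a ** x)) = \tr ((B *m rho a) *m rho x).
    by rewrite rhoM mulmxA.
  have [b A'b|B' /mapP [B BI ->] AB] := irrA' [seq B *m rho a | B <- I].
    have [|B BI] := cov (a ** b); first by exists a, b.
    by rewrite /vanish /= E => BF; exists (B *m rho a); first exact: (map_f (fun B => B *m rho a)).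
  by exists B => // b /AB; rewrite /vanish /= E.
- by exists B => // _ [a [b [Aa A'b ->]]]; apply: AB.
Qed.

Definition lin_comp : set G := [set g | exists A, [/\ lin_irr A, A e & A g]].

Lemma lin_irr_set1 g : lin_irr [set g].
Proof. by move=> I /(_ g erefl) [B BI Bg]; exists B => // _ ->. Qed.

Lemma lin_comp1 : lin_comp e.
Proof. by exists [set e]; split=> //; exact: lin_irr_set1. Qed.

Lemma lin_compM x y : lin_comp x -> lin_comp y -> lin_comp (x ** y).
Proof.
move=> [A [irrA Ae Ax]] [A' [irrA' A'e A'y]].
exists [set x | exists a b, [/\ A a, A' b & x = a ** b]]; split=> /=.
- exact: lin_irr_mul.
- by exists e, e; rewrite (gmul1 HG).
- by exists x, y.
Qed.

Lemma lin_comp_subgroup : is_subgroup mul inv e lin_comp.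
Proof.
split=> [|x y|x [A [irrA Ae Ax]]]; [exact: lin_comp1|exact: lin_compM|].
(* Translation by [inv x] moves [x] to [e] and [e] to [inv x]. *)
exists ((fun g => inv x ** g ** e) @` A); split; first exact: lin_irr_shift.
  by exists x => //; rewrite (gmulV HG) (gmul1 HG).
by exists e => //; rewrite !(gmulr1 HG).
Qed.

Lemma lin_comp_normal : is_normal mul inv lin_comp.
Proof.
move=> g x [A [irrA Ae Ax]].
exists ((fun y => g ** y ** inv g) @` A); split; first exact: lin_irr_shift.
  by exists e => //; rewrite (gmulr1 HG) (gmulrV HG).
by exists x.
Qed.

(** If no [B] in the list works, induction builds a single irreducible set through [e] contained in
    no [vanish B]: a product of sets through [e] contains both factors. *)
Lemma lin_comp_irr : lin_irr lin_comp.
Proof.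
move=> I cov; apply: contrapT => H.
suff [A [irrA Ae AI]] : exists A : set G,
    [/\ lin_irr A, A e & forall B, B \in I -> ~ (A `<=` vanish B)].
  have [g Ag|B BI AB] := irrA I; last by case: (AI B BI).
  by apply: cov; exists A.
have {}H B : B \in I -> ~ (lin_comp `<=` vanish B) by move=> BI cB; apply: H; exists B.
elim: I H {cov} => [|B I IHI] H.
  by exists [set e]; split=> //; exact: lin_irr_set1.
have [B' B'I|A [irrA Ae AI]] := IHI; first by apply: H; rewrite inE B'I orbT.
have [x [A' [irrA' A'e A'x]] nx] : exists2 x, lin_comp x & ~ vanish B x.
  apply: contrapT => nex; apply: (H B); first exact: mem_head.
  by move=> x cx; apply: contrapT => nx; apply: nex; exists x.
exists [set x | exists a b, [/\ A a, A' b & x = a ** b]]; split.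
- exact: lin_irr_mul.
- by exists e, e; rewrite (gmul1 HG).
- move=> B'; rewrite inE => /predU1P [->|B'I] sub.
    by apply: nx; apply: sub; exists e, x; rewrite (gmul1 HG).
  by apply: (AI B' B'I) => a Aa; apply: sub; exists a, e; rewrite (gmulr1 HG).
Qed.

(** The closure of [lin_comp] is irreducible and contains [e], hence lies in [lin_comp]. *)
Lemma lin_comp_lin_closed : lin_closed lin_comp.
Proof.
move=> g ng; apply: contrapT => H; apply: ng.
exists [set x | forall B, lin_comp `<=` vanish B -> vanish B x]; split.
- move=> I cov; have [x cx|B BI cB] := lin_comp_irr (I := I).
    by apply: cov => B; apply.
  by exists B => // x; apply.
- by move=> B; apply; exact: lin_comp1.
- by move=> B cB; apply: contrapT => nB; apply: H; exists B.
Qed.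

Let fin_cov (X : set G) := exists (N : nat) (s : nat -> G),
  forall g, X g -> exists i, (i < N)%N /\ lin_comp (inv (s i) ** g).

(** Noetherian induction on the rank of [W]: if [zset W] is irreducible it lies in one coset;
    otherwise finitely many sets [vanish B] cover it, and each cuts it in a set given by a space of
    smaller rank. *)
Lemma lin_comp_finite_index : finite_index mul inv lin_comp.
Proof.
pose zset (W : 'M[K]_(D * D)) : set G := [set g | (mxvec (rho g) <= W)%MS].
suff F W : fin_cov (zset W).
  have [N [s Ns]] := F 1%:M; exists N, s => g; apply: Ns.
  exact: submx1.
have [r] := ubnP (\rank W); elim: r W => // r IHr W; rewrite ltnS => Wr.
have [[g0 Wg0]|nW] := pselect (exists g, zset W g); last first.
  by exists 0%N, (fun=> e) => g Wg; case: nW; exists g.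
have [irrW|] := pselect (lin_irr (zset W)).
  exists 1%N, (fun=> g0) => g Wg; exists 0%N; split=> //.
  exists ((fun x => inv g0 ** x ** e) @` zset W); split.
  - exact: lin_irr_shift.
  - by exists g0 => //; rewrite (gmulV HG) (gmul1 HG).
  - by exists g => //; rewrite (gmulr1 HG).
move=> /existsNP [I /not_implyP [cov nI]].
have {}nI B : B \in I -> ~ (zset W `<=` vanish B) by move=> BI ?; apply: nI; exists B.
have sub B : B \in I -> fin_cov (zset W `&` vanish B).
  (* In vectorised form [vanish B] is the kernel of [b]. If intersecting with this kernel kept the
     rank of [W], then [zset W] would lie in [vanish B]. *)
  move=> BI; have [b bP] := mxtrace_functional B.
  have [N [s Ns]] : fin_cov (zset (W :&: kermx b)%MS).
    apply: IHr; apply: leq_trans Wr; rewrite ltn_neqAle mxrankS ?capmxSl // andbT.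
    apply/negP => /eqP rk; apply: (nI B BI) => g Wg.
    have : (W <= W :&: kermx b)%MS.
      by have := mxrank_leqif_sup (capmxSl W (kermx b)) => /geq_leqif <-; rewrite rk.
    rewrite sub_capmx => /andP [_ Wb]; rewrite /vanish /= bP.
    by have /sub_kermxP -> := submx_trans Wg Wb; rewrite mxE.
  exists N, s => g [Wg Bg]; apply: Ns.
  rewrite /zset /= sub_capmx Wg; apply/sub_kermxP/matrixP => i j.
  by rewrite !ord1 -bP mxE.
have cov' : exists (N : nat) (s : nat -> G), forall B g, B \in I ->
    zset W g -> vanish B g -> exists i, (i < N)%N /\ lin_comp (inv (s i) ** g).
  elim: I sub {cov nI} => [|B I IHI] sub; first by exists 0%N, (fun=> e).
  have [B' B'I|N [s Ns]] := IHI; first by apply: sub; rewrite inE B'I orbT.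
  have [N' [s' Ns']] := sub B (mem_head _ _).
  exists (N + N')%N, (fun i => if (i < N)%N then s i else s' (i - N)%N) => B' g.
  rewrite inE => /predU1P [-> Wg Bg|B'I Wg Bg].
    have [i [iN' ci]] := Ns' g (conj Wg Bg).
    by exists (N + i)%N; rewrite ltn_add2l iN' ltnNge [(N <= _)%N]leq_addr /= addKn.
  have [i [iN ci]] := Ns B' g B'I Wg Bg.
  by exists i; rewrite iN; split=> //; apply: leq_trans iN (leq_addr _ _).
have [N [s Ns]] := cov'; exists N, s => g Wg.
by have [B BI Bg] := cov g Wg; apply: (Ns B).
Qed.

(** Irreducibility of a power of [A], for conditions closed in each variable separately; the
    variables are released one at a time. *)
Lemma lin_irr_multi A N (J : eqType) (s : seq J) (Z : J -> ('I_N -> G) -> Prop) :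
  lin_irr A ->
  (forall j g i, lin_closed [set x | Z j (upd g i x)]) ->
  (forall g, (forall i, A (g i)) -> exists2 j, j \in s & Z j g) ->
  exists2 j, j \in s & forall g, (forall i, A (g i)) -> Z j g.
Proof.
move=> irrA clZ cov.
(* Variables below [m] are free, those from [m] on are frozen at [f]. *)
suff F m : forall f, (forall i, A (f i)) -> exists2 j, j \in s &
    forall f', (forall i, A (f' i)) -> (forall i : 'I_N, (m <= i)%N -> f' i = f i) -> Z j f'.
  have [a Aa] := lin_irr_nonempty irrA.
  have [|j js jP] := F N (fun=> a); first by [].
  by exists j => // g Ag; apply: jP => // i; rewrite leqNgt ltn_ord.
elim: m => [|m IHm] f Af.
  have [j js Zj] := cov f Af; exists j => // f' _ f'f.
  by have -> : f' = f by apply/funext => i; apply: f'f.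
have [mN|Nm] := ltnP m N; last first.
  have [j js jP] := IHm f Af; exists j => // f' Af' _; apply: jP => // i.
  by move=> mi; have := leq_trans Nm mi; rewrite leqNgt ltn_ord.
pose i0 := Ordinal mN.
have Aupd h x : (forall i, A (h i)) -> A x -> forall i, A (upd h i0 x i).
  by move=> Ah Ax i; rewrite /upd; case: ifP.
have [j js|x Ax|j js jP] := lin_irr_closed (s := s) (C := fun j => [set x | forall f',
   (forall i, A (f' i)) -> (forall i : 'I_N, (m < i)%N -> f' i = f i) ->
     Z j (upd f' i0 x)]) irrA.
- move=> x /= /existsNP [f' /not_implyP [Af' /not_implyP [f'f nZ]]].
  have [B nB sB] := clZ j f' i0 x nZ; exists B => // y /= Zy; apply: sB.
  exact: Zy.
- have [j js jP] := IHm _ (Aupd f x Af Ax); exists j => // f' Af' f'f.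
  apply: jP => [|i mi]; first exact: Aupd.
  rewrite /upd; case: eqP => // ii0; apply: f'f.
  by rewrite ltn_neqAle mi andbT; apply: contra_not_neq ii0 => mi'; apply: val_inj.
- exists j => // f' Af' f'f; have -> : f' = upd f' i0 (f' i0).
    by apply/funext => i; rewrite /upd; case: eqP => // ->.
  exact: jP.
Qed.

Definition word N (g : 'I_N -> G) (s : 'S_N) := \big[mul/e]_(i < N) g (s i).

Lemma hom_word N (g : 'I_N -> G) s : rho (word g s) = \prod_(i < N) rho (g (s i)).
Proof. by apply: big_morph; [exact: rhoM|exact: hom1 hrho]. Qed.

(** The letter [i] occurs exactly once in the word, at position [(s^-1)%g i]. *)
Lemma word_linear N (g : 'I_N -> G) i s : exists L U, forall x,
  rho (word (upd g i x) s) = L *m rho x *m U.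
Proof.
have [L [U LU]] := prod_mx_insert (fun j => rho (g (s j)))
  (index_enum_uniq 'I_N) (mem_index_enum ((s^-1)%g i)).
exists L, U => x; rewrite hom_word -LU; apply: eq_bigr => j _.
by rewrite /upd -(inj_eq (@perm_inj _ s) j) permKV; case: ifP.
Qed.

(** There are finitely many [s], and each condition is closed in every letter, so [lin_irr_multi]
    provides one [s] for all words. The set [BB] will consist of a single test matrix or of all
    matrices. *)
Lemma lin_comp_words N (BB : set 'M[K]_D) :
  (forall g : 'I_N -> G, (forall i, lin_comp (g i)) -> exists2 s, s != 1%g &
     forall B, BB B -> \tr (B *m (rho (word g s) - rho (word g 1%g))) = 0) ->
  forall x y B, lin_comp x -> lin_comp y -> BB B ->
    \tr (B *m (rho (x ** y) - rho (y ** x))) = 0.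
Proof.
move=> rew x y B cx cy BBB.
have [s s1 sP] : exists2 s : 'S_N, s != 1%g & forall g : 'I_N -> G,
    (forall i, lin_comp (g i)) ->
    forall B, BB B -> \tr (B *m (rho (word g s) - rho (word g 1%g))) = 0.
  have [s g i x' /= /existsNP [B' /not_implyP [BB' nB']]|g cg|s] :=
    lin_irr_multi (s := [seq s <- enum 'S_N | s != 1%g]) (Z := fun s g =>
      forall B, BB B -> \tr (B *m (rho (word g s) - rho (word g 1%g))) = 0) lin_comp_irr.
  - have [L [U LU]] := word_linear g i s.
    have [L' [U' LU']] := word_linear g i 1%g.
    have E z : \tr (B' *m (rho (word (upd g i z) s) - rho (word (upd g i z) 1%g))) =
        \tr ((U *m B' *m L - U' *m B' *m L') *m rho z).
      rewrite LU LU' mulmxBr mulmxBl !raddfB /=; congr (_ - _).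
        by rewrite !mulmxA mxtrace_mulC !mulmxA.
      by rewrite !mulmxA mxtrace_mulC !mulmxA.
    exists (U *m B' *m L - U' *m B' *m L'); first by rewrite /vanish /= -E.
    by move=> z /= /(_ B' BB'); rewrite E.
  - have [s s1 sP] := rew g cg; exists s => //.
    by rewrite mem_filter s1 mem_enum.
  - by rewrite mem_filter => /andP [s1 _] sP; exists s.
(* With [y] as letter [s a], [x] as letter [s b] and [e] elsewhere, the word of [s] is [y ** x] and
   that of the identity is [x ** y]. *)
have [a [b [ab sba]]] := perm_inversion s1.
pose g := upd (upd (fun=> e) (s a) y) (s b) x.
have sab : s a != s b by apply: contraTneq sba => ->; rewrite ltnn.
have ga : g (s a) = y by rewrite /g /upd (negPf sab) eqxx.
have gb : g (s b) = x by rewrite /g /upd eqxx.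
have g1 j : j != s a -> j != s b -> rho (g j) = 1.
  by rewrite /g /upd => /negPf -> /negPf ->; exact: hom1 hrho.
have cg i : lin_comp (g i).
  by rewrite /g /upd; do 2?[case: ifP => // _]; exact: lin_comp1.
have := sP g cg B BBB.
rewrite !hom_word (prod_mx_two ab); last first.
  by move=> j ja jb; apply: g1; rewrite inj_eq //; apply: perm_inj.
rewrite (eq_bigr (fun i => rho (g i))); last by move=> i _; rewrite perm1.
rewrite (prod_mx_two sba) => [|j jb ja]; last exact: g1.
rewrite ga gb -!rhoM -opprB mulmxN raddfN /= => /eqP.
by rewrite oppr_eq0 => /eqP.
Qed.
End Component.

(** * Traces of representations *)

Section Continuity.
Variables (R : realType) (G : topologicalType).
Local Notation K := (Cplx R).

Lemma mx_continuous m n (f : G -> 'M[K]_(m, n)) :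
  (forall i j, continuous (fun g => f g i j)) -> continuous f.
Proof.
move=> cf g A [P Pnbhs PA].
have F (ij : 'I_m * 'I_n) : \forall x \near g, P ij.1 ij.2 (f x ij.1 ij.2).
  exact: (cf ij.1 ij.2 g _ (Pnbhs ij.1 ij.2)).
have : \forall x \near g, forall ij : 'I_m * 'I_n, P ij.1 ij.2 (f x ij.1 ij.2).
  exact: filter_forall.
by apply: filterS => x Px; apply: PA => i j; apply: (Px (i, j)).
Qed.

Lemma mx_entry_continuous m n (f : G -> 'M[K]_(m, n)) i j :
  continuous f -> continuous (fun g => f g i j).
Proof.
move=> cf g; apply: (@continuous_comp _ _ _ f (fun M => M i j)).
  exact: cf.
exact: coord_continuous.
Qed.

Lemma sum_continuous (I : finType) (F : I -> G -> K) :
  (forall i, continuous (F i)) -> continuous (fun g => \sum_i F i g).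
Proof.
move=> cF; elim: (index_enum I) => [|i r IHr].
  by under eq_fun do rewrite big_nil; exact: cst_continuous.
by under eq_fun do rewrite big_cons; move=> g; apply: cvgD; [exact: cF|exact: IHr].
Qed.

Lemma mulmx_continuous m n p (f : G -> 'M[K]_(m, n)) (h : G -> 'M[K]_(n, p)) :
  continuous f -> continuous h -> continuous (fun g => f g *m h g).
Proof.
move=> cf ch; apply: mx_continuous => i j.
under eq_fun do rewrite mxE.
apply: sum_continuous => l g.
by apply: cvgM; [exact: mx_entry_continuous cf g|exact: mx_entry_continuous ch g].
Qed.
End Continuity.

Section Representations.
Variables (R : realType) (G : topologicalType).
Variables (mul : G -> G -> G) (inv : G -> G) (e : G).
Hypothesis TG : topological_group mul inv e.
Let HG : is_group mul inv e. Proof. by case: TG. Qed.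
Local Notation K := (Cplx R).
Local Notation "x ** y" := (mul x y) (at level 40, left associativity).
Local Notation cont_rep := (@cont_rep G mul e R _).

Lemma cont_repI k (pi : G -> 'M[K]_k) :
  mx_hom mul e pi -> continuous pi -> cont_rep pi.
Proof.
move=> hpi cpi; have [pi1 piM] := hpi; split=> // g.
by have /mulmx1_unit [] := homV HG hpi g.
Qed.

(** In the first alternative the image of [F] is invariant, which gives a subrepresentation; in the
    second the kernel of [L] is, which gives a quotient. *)
Lemma compress_rep k r (pi : G -> 'M[K]_k) (F : 'M[K]_(k, r)) (L : 'M[K]_(r, k)) :
  cont_rep pi -> L *m F = 1%:M ->
  (forall g, pi g *m F = F *m L *m pi g *m F) \/
  (forall g, L *m pi g = L *m pi g *m F *m L) ->
  cont_rep (fun g => L *m pi g *m F).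
Proof.
move=> [pi1 piM _ cpi] LF inva; apply: cont_repI.
  split=> [|g h]; first by rewrite pi1 mulmx1.
  rewrite piM; case: inva => inva.
    transitivity (L *m pi g *m (pi h *m F)); first by rewrite !mulmxA.
    by rewrite inva !mulmxA.
  transitivity (L *m pi g *m F *m L *m pi h *m F); last by rewrite !mulmxA.
  by rewrite -inva !mulmxA.
by do 2?apply: mulmx_continuous => //; exact: cst_continuous.
Qed.

(** [pi1] acts on an invariant subspace and [pi2] on the quotient, realised on the image of the
    complementary idempotent [E]. Traces add up because [F *m L + E = 1%:M]. *)
Lemma reducible_trace k (pi : G -> 'M[K]_k) : cont_rep pi -> (0 < k)%N ->
  ~ irreducible_rep pi -> exists r1 r2 (pi1 : G -> 'M[K]_r1) (pi2 : G -> 'M[K]_r2),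
  [/\ (r1 < k)%N /\ (r2 < k)%N, cont_rep pi1, cont_rep pi2 &
      forall g, \tr (pi g) = \tr (pi1 g) + \tr (pi2 g)].
Proof.
move=> cpi k_gt0 nirr.
have [W [Wst W0 Wk]] : exists W : 'M[K]_k, [/\ forall g, stablemx W (pi g)^T,
    (0 < \rank W)%N & (\rank W < k)%N].
  apply: contrapT => H; apply: nirr; split=> // W Wst.
  have [->|W0] := eqVneq (\rank W) 0%N; first by left.
  right; apply/eqP; rewrite eqn_leq rank_leq_row leqNgt; apply/negP => Wk.
  by apply: H; exists W; rewrite lt0n.
set r := \rank W in W0 Wk.
have [V [V' [VV Vst]]] : exists (V : 'M[K]_(r, k)) (V' : 'M[K]_(k, r)),
    V *m V' = 1%:M /\ forall g, exists X, V *m (pi g)^T = X *m V.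
  exists (row_base W), (pinvmx (row_base W)); split.
    exact/mulmxVp/row_base_free.
  move=> g; apply/submxP; have := Wst g; rewrite -stablemx_row_base.
  exact.
have [F [L [LF FL]]] : exists (F : 'M[K]_(k, r)) (L : 'M[K]_(r, k)),
    L *m F = 1%:M /\ forall g, pi g *m F = F *m L *m pi g *m F.
  exists V^T, V'^T; split=> [|g]; first by rewrite -trmx_mul VV trmx1.
  apply: trmx_inj; rewrite !trmx_mul !trmxK !mulmxA.
  have [X ->] := Vst g.
  by rewrite -[X *m V *m V']mulmxA VV mulmx1.
pose E := 1%:M - F *m L.
have EE : E *m E = E.
  rewrite /E mulmxBl mul1mx mulmxBr mulmx1 mulmxA -[F *m L *m F]mulmxA LF mulmx1.
  by rewrite subrr subr0.
have [r2 [rE [F2 [L2 [FL2 LF2]]]]] : exists r2, (r2 + r = k)%N /\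
    exists (F2 : 'M[K]_(k, r2)) (L2 : 'M[K]_(r2, k)), F2 *m L2 = E /\ L2 *m F2 = 1%:M.
  (* The rank of [E] is read off from its trace, in characteristic zero. *)
  exists (\rank E); split; last exact: idem_factor EE.
  apply/eqP; rewrite -(eqr_nat K) natrD -(idem_trace EE) /E raddfB /= mxtrace1 mxtrace_mulC LF.
  by rewrite mxtrace1 subrK.
have Epi g : E *m pi g = E *m pi g *m E.
  rewrite {3}/E mulmxBr mulmx1 mulmxA -[X in _ - X *m L]mulmxA FL.
  rewrite [X in _ - X *m _]mulmxA.
  suff -> : E *m (F *m L *m pi g) = 0 by rewrite !mul0mx subr0.
  rewrite /E mulmxBl mul1mx !mulmxA -[F *m L *m F]mulmxA LF mulmx1.
  by rewrite subrr.
exists r, r2, (fun g => L *m pi g *m F), (fun g => L2 *m pi g *m F2).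
split.
- by split=> //; move: W0; rewrite -(ltn_add2l r2) addn0 rE.
- by apply: compress_rep => //; left.
- apply: compress_rep => //; right => g.
  rewrite -[LHS]mul1mx -LF2 -!mulmxA (mulmxA F2) FL2 Epi.
  by rewrite -FL2 !mulmxA LF2 mul1mx.
- move=> g; rewrite -!mulmxA !(mxtrace_mulC L) !(mxtrace_mulC L2) -!mulmxA.
  rewrite (mxtrace_mulC (pi g)) FL2 (mxtrace_mulC (pi g)) -mxtraceD -mulmxDl.
  by rewrite addrC subrK mul1mx.
Qed.

(* The trace of a representation is the sum of the traces of its composition
   factors. *)
Lemma trace_of_irreducibles (J : finType) (c : J -> K) (x : J -> G) :
  (forall k (pi : G -> 'M[K]_k), cont_rep pi -> irreducible_rep pi ->
     \sum_j c j *: pi (x j) = 0) ->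
  forall k (pi : G -> 'M[K]_k), cont_rep pi -> \sum_j c j * \tr (pi (x j)) = 0.
Proof.
move=> irr0 k; have [n] := ubnP k; elim: n k => // n IHn k; rewrite ltnS => kn pi cpi.
case: (posnP k) => [k0|k_gt0].
  rewrite big1 // => j _; rewrite /mxtrace big1 ?mulr0 // => i _.
  by have := ltn_ord i; rewrite {2}k0.
have [irr|nirr] := pselect (irreducible_rep pi).
  have := congr1 mxtrace (irr0 _ _ cpi irr); rewrite raddf0 raddf_sum /= => s0.
  by rewrite -[RHS]s0; apply: eq_bigr => j _; rewrite mxtraceZ.
have [r1 [r2 [pi1 [pi2 [[r1k r2k] c1 c2 trE]]]]] := reducible_trace cpi k_gt0 nirr.
under eq_bigr do rewrite trE mulrDr.
by rewrite big_split /= !IHn ?addr0 //; apply: leq_trans kn.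
Qed.
End Representations.

(** * Virtual characters and the alternating sum *)

Section VirtualCharacters.
Variables (R : realType) (G : topologicalType).
Variables (mul : G -> G -> G) (inv : G -> G) (e : G).
Hypothesis TG : topological_group mul inv e.
Let HG : is_group mul inv e. Proof. by case: TG. Qed.
Local Notation K := (Cplx R).
Local Notation "x ** y" := (mul x y) (at level 40, left associativity).
Local Notation cont_rep := (@cont_rep G mul e R _).

Lemma block_rep k l (pi : G -> 'M[K]_k) (tau : G -> 'M[K]_l) :
  cont_rep pi -> cont_rep tau -> cont_rep (fun g => block_mx (pi g) 0 0 (tau g)).
Proof.
move=> [pi1 piM _ cpi] [tau1 tauM _ ctau]; apply: (cont_repI TG).
  split=> [|g h]; first by rewrite pi1 tau1 -scalar_mx_block.
  by rewrite mulmx_block !mul0mx !mulmx0 !addr0 add0r piM tauM.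
apply: mx_continuous => i j; rewrite -(splitK i) -(splitK j).
case: (fintype.split i) => i'; case: (fintype.split j) => j' /=.
- by under eq_fun do rewrite block_mxEul; exact: mx_entry_continuous.
- by under eq_fun do rewrite block_mxEur mxE; exact: cst_continuous.
- by under eq_fun do rewrite block_mxEdl mxE; exact: cst_continuous.
- by under eq_fun do rewrite block_mxEdr; exact: mx_entry_continuous.
Qed.

Lemma tens_rep k l (pi : G -> 'M[K]_k) (tau : G -> 'M[K]_l) :
  cont_rep pi -> cont_rep tau -> cont_rep (fun g => pi g *t tau g).
Proof.
move=> [pi1 piM _ cpi] [tau1 tauM _ ctau]; apply: (cont_repI TG).
  split=> [|g h]; last by rewrite piM tauM tensmx_mul.
  rewrite pi1 tau1; apply/matrixP => i j.
  case: (mxtens_indexP i) => i0 i1; case: (mxtens_indexP j) => j0 j1.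
  rewrite tensmxE !mxE -natrM mulnb (can_eq (@mxtens_indexK _ _)).
  by rewrite xpair_eqE.
apply: mx_continuous => i j.
case: (mxtens_indexP i) => i0 i1; case: (mxtens_indexP j) => j0 j1.
under eq_fun do rewrite tensmxE.
by move=> g; apply: cvgM; [exact: mx_entry_continuous cpi g|exact: mx_entry_continuous ctau g].
Qed.

Lemma mxtrace_tens k l (A : 'M[K]_k) (B : 'M[K]_l) : \tr (A *t B) = \tr A * \tr B.
Proof.
by rewrite /mxtrace mulr_sum; apply: eq_bigr => i _; rewrite mxE.
Qed.

(** Coefficients are complex, so that, with tensor products, all polynomials in characters belong to
    the class, constants included. *)
Inductive vchar : (G -> K) -> Prop :=
| vchar_rep k (pi : G -> 'M[K]_k) : cont_rep pi -> vchar (fun g => \tr (pi g))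
| vchar_lin a f1 f2 : vchar f1 -> vchar f2 -> vchar (fun g => a * f1 g + f2 g).

Lemma vchar_ext f h : vchar f -> f =1 h -> vchar h.
Proof. by move=> vf /funext <-. Qed.

Lemma vchar0 : vchar (fun=> 0).
Proof.
apply: (vchar_ext (f := fun g => \tr (1%:M : 'M[K]_0))).
  apply: (vchar_rep (pi := fun=> 1%:M)); apply: (cont_repI TG).
    by split=> // g h; rewrite mulmx1.
  exact: cst_continuous.
by move=> g; rewrite mxtrace1.
Qed.

Lemma vchar_scale a f : vchar f -> vchar (fun g => a * f g).
Proof.
move=> vf; apply: (vchar_ext (vchar_lin a vf vchar0)) => g.
exact: addr0.
Qed.

Lemma vchar_cst c : vchar (fun=> c).
Proof.
have v1 : vchar (fun=> \tr (1%:M : 'M[K]_1)).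
  apply: (vchar_rep (pi := fun=> 1%:M)); apply: (cont_repI TG).
    by split=> // g h; rewrite mulmx1.
  exact: cst_continuous.
apply: (vchar_ext (vchar_scale c v1)) => g.
by rewrite mxtrace1 mulr1.
Qed.

Lemma vcharM f h : vchar f -> vchar h -> vchar (fun g => f g * h g).
Proof.
move=> vf; elim=> [l tau ctau|a h1 h2 _ IH1 _ IH2]; last first.
  by apply: (vchar_ext (vchar_lin a IH1 IH2)) => g; rewrite mulrDr mulrCA.
elim: vf => [k pi cpi|a f1 f2 _ IH1 _ IH2]; last first.
  by apply: (vchar_ext (vchar_lin a IH1 IH2)) => g; rewrite mulrDl mulrA.
by apply: (vchar_ext (vchar_rep (tens_rep cpi ctau))) => g; rewrite mxtrace_tens.
Qed.

Lemma vcharBc f c : vchar f -> vchar (fun g => f g - c).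
Proof.
move=> vf; apply: (vchar_ext (vchar_lin 1 vf (vchar_cst (- c)))) => g.
by rewrite mul1r.
Qed.

Lemma vchar_prod (I : Type) (r : seq I) (F : I -> G -> K) :
  (forall i, vchar (F i)) -> vchar (fun g => \prod_(i <- r) F i g).
Proof.
move=> vF; elim: r => [|i r IHr].
  by apply: (vchar_ext (vchar_cst 1)) => g; rewrite big_nil.
by apply: (vchar_ext (vcharM (vF i) IHr)) => g; rewrite big_cons.
Qed.

Section Bounded.
Variable n : nat.
Hypothesis dim_le : forall k (pi : G -> 'M[K]_k),
  cont_rep pi -> irreducible_rep pi -> (k <= n)%N.
Let N := (n * n).+1.

Lemma vchar_standard f (g : 'I_N -> G) h : vchar f ->
  \sum_(s : 'S_N) (-1) ^+ s * f (word mul e g s ** h) = 0.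
Proof.
elim=> [k pi cpi|a f1 f2 _ IH1 _ IH2]; last first.
  under eq_bigr do rewrite mulrDr mulrCA.
  by rewrite big_split /= -mulr_sumr IH1 IH2 mulr0 addr0.
apply: (trace_of_irreducibles TG (c := fun s : 'S_N => (-1) ^+ s)
   (x := fun s => word mul e g s ** h)) cpi => {f}k {}pi cpi irr.
have hpi := cont_rep_hom cpi.
under eq_bigr do rewrite (homM hpi) scalemxAl (hom_word hpi).
rewrite -mulmx_suml (standard_identity (fun i => pi (g i))) ?mul0mx //.
by have kn := dim_le cpi irr; rewrite ltnS leq_mul.
Qed.

(** The product over [s != 1%g] of [f s] minus its value at the word of [s] vanishes at all those
    words. So [vchar_standard] leaves only its value at the identity word, which must be zero. *)
Lemma vchar_rewritable (f : 'S_N -> G -> K) (g : 'I_N -> G) h :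
  (forall s, vchar (f s)) ->
  exists2 s, s != 1%g & f s (word mul e g s ** h) = f s (word mul e g 1%g ** h).
Proof.
move=> vf; apply: contrapT => H.
pose P x := \prod_(s <- [seq s : 'S_N <- enum 'S_N | s != 1%g])
  (f s x - f s (word mul e g s ** h)).
have vP : vchar P by apply: vchar_prod => s; apply: vcharBc.
have := vchar_standard g h vP; rewrite (bigD1 1%g) //= big1 => [|s s1].
  rewrite addr0 odd_perm1 expr0 mul1r => /eqP.
  rewrite /P prodf_seq_eq0 => /hasP [s]; rewrite mem_filter => /andP [s1 _].
  by rewrite subr_eq0 => /eqP E; apply: H; exists s.
apply/eqP; rewrite mulf_eq0 /P prodf_seq_eq0; apply/orP; right.
apply/hasP; exists s; first by rewrite mem_filter s1 mem_enum.
by rewrite /= subrr eqxx.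
Qed.
End Bounded.
End VirtualCharacters.

(** * Rewriting words in G *)

Section Rewriting.
Variables (R : realType) (G : topologicalType).
Variables (mul : G -> G -> G) (inv : G -> G) (e : G).
Hypothesis TG : topological_group mul inv e.
Let HG : is_group mul inv e. Proof. by case: TG. Qed.
Local Notation K := (Cplx R).
Local Notation "x ** y" := (mul x y) (at level 40, left associativity).
Local Notation cont_rep := (@cont_rep G mul e R _).
Local Notation vchar := (@vchar R G mul e).

Lemma gmul_continuous (f h : G -> G) :
  continuous f -> continuous h -> continuous (fun g => f g ** h g).
Proof.
move=> cf ch g; have [_ cM _] := TG.
apply: (@cvg_comp _ _ _ (fun g => (f g, h g)) (fun p => p.1 ** p.2) _ (nbhs (f g, h g))).
  by apply: cvg_pair; [exact: cf|exact: ch].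
exact: (cM (f g, h g)).
Qed.

Lemma shift_continuous a b : continuous (fun g => a ** g ** b).
Proof.
apply: gmul_continuous; last exact: cst_continuous.
by apply: gmul_continuous => [|g]; [exact: cst_continuous|exact: cvg_id].
Qed.

(** The trace of [B *m rho g] is continuous in [g], so the linear topology is coarser than the given
    one. *)
Lemma lin_closed_closed k (rho : G -> 'M[K]_k) C :
  continuous rho -> lin_closed rho C -> closed C.
Proof.
move=> crho clC p pC; apply: contrapT => nCp.
have [B /eqP nB CB] := clC p nCp.
have cB : continuous (fun g => \tr (B *m rho g)).
  apply: sum_continuous => i.
  apply: (mx_entry_continuous (f := fun g => B *m rho g)).
  by apply: (mulmx_continuous (f := fun=> B) _ crho); exact: cst_continuous.
have near0 : \forall g \near p, \tr (B *m rho g) != 0.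
  by apply: cvgr_neq0 nB; exact: cB.
have [g [/CB Bg /eqP]] := pC _ near0.
by rewrite Bg.
Qed.

(** * Indicators of closed normal subgroups of finite index *)

Section Clopen.
Variable H : set G.
Hypotheses (sH : is_subgroup mul inv e H) (nH : is_normal mul inv H).
Hypotheses (fH : finite_index mul inv H) (cH : closed H).
Let HM x y : H x -> H y -> H (x ** y). Proof. by case: sH => _ hM _; apply: hM. Qed.
Let HV x : H x -> H (inv x). Proof. by case: sH => _ _; apply. Qed.
Let HMr x y : H y -> H (x ** y) -> H x.
Proof. by move=> Hy /HM /(_ (HV Hy)); rewrite (gmulrK HG). Qed.
Let HJ x y : H (inv x ** y ** x) <-> H y.
Proof.
split=> [/(nH x)|/(nH (inv x))]; last by rewrite (ginvK HG).
by rewrite !(gmulA HG) (gmulrV HG) (gmul1 HG) (gmulrK HG).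
Qed.

Let near_notin a b x : ~ H (a ** x ** b) -> \forall y \near x, ~ H (a ** y ** b).
Proof.
move=> nHx; have := @shift_continuous a b x (~` H); apply.
by apply: open_nbhs_nbhs; split=> //; exact: closed_openC.
Qed.

(** [H] is open as well as closed: its complement is a finite union of closed cosets. *)
Lemma clopen_near a b x :
  \forall y \near x, (H (a ** y ** b) : Prop) = H (a ** x ** b).
Proof.
have [Hx|nHx] := pselect (H (a ** x ** b)); last first.
  by have := near_notin nHx; apply: filterS => y nHy; apply/propext; split.
have [N [s sP]] := fH.
have : \forall y \near x, forall i : 'I_N, ~ H (s i) -> ~ H (inv (s i) ** (a ** y ** b)).
  apply: filter_forall => i; have [Hsi|nHsi] := pselect (H (s i)).
    by apply: nearW => y /(_ Hsi).
  have : ~ H (inv (s i) ** a ** x ** b).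
    rewrite -!(gmulA HG) (gmulA HG a) => /(HMr Hx) /HV.
    by rewrite (ginvK HG).
  move=> /near_notin; apply: filterS => y nHy _.
  by rewrite !(gmulA HG).
apply: filterS => y yP; apply/propext; split=> // _.
have [i [iN Hi]] := sP (a ** y ** b).
have Hsi : H (s i) by apply: contrapT => nHsi; apply: (yP (Ordinal iN)).
by have := HM Hsi Hi; rewrite (gmulVK HG).
Qed.

Lemma exact_transversal : exists N (s : 'I_N -> G),
  forall g, exists i, forall j, H (inv (s j) ** g) <-> j = i.
Proof.
have [N [s sP]] := fH.
(* [T] keeps the first representative of each coset in the list [s]. *)
pose T := [set i : 'I_N | [forall j : 'I_N, (j < i)%N ==> ~~ `[< H (inv (s j) ** s i) >]]]%SET.
exists #|T|, (fun t : 'I_#|T| => s (enum_val t)) => g.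
pose P i := (i < N)%N && `[< H (inv (s i) ** g) >].
have exP : exists i, P i.
  by have [i [iN Hi]] := sP g; exists i; rewrite /P iN; apply/asboolP.
case: (ex_minnP exP) => i0 /andP [i0N /asboolP Hi0] min.
pose i := Ordinal i0N.
have coset j k : H (inv (s j) ** g) -> H (inv (s k) ** g) -> H (inv (s j) ** s k).
  move=> Hj Hk; apply: (HMr Hk).
  by rewrite (gmulA HG) (gmulrK HG).
have iT : i \in T.
  rewrite inE; apply/forallP => j; apply/implyP => ji; apply/negP => /asboolP Hji.
  have := min j; rewrite leqNgt ji => F; suff : P j by move=> /F.
  rewrite /P ltn_ord; apply/asboolP.
  by have := HM Hji Hi0; rewrite (gmulA HG) (gmulrK HG).
exists (enum_rank_in iT i) => j; split=> [Hj|->]; last by rewrite enum_rankK_in.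
apply: enum_val_inj; rewrite enum_rankK_in //; apply: val_inj => /=.
have := enum_valP j; rewrite inE => /forallP /(_ i) /implyP jT.
apply/eqP; rewrite eqn_leq min ?andbT; last first.
  by rewrite /P ltn_ord; apply/asboolP.
rewrite leqNgt; apply/negP => /jT /negP; apply; apply/asboolP.
exact: coset.
Qed.

(** In the permutation representation on G/H, normality makes [g] fix every coset or none, so the
    trace is the index times the indicator. *)
Lemma indicator_vchar : vchar (fun g => `[< H g >]%:R).
Proof.
have [N [s sP]] := exact_transversal.
pose P g : 'M[K]_N := \matrix_(i, j) `[< H (inv (s i) ** g ** s j) >]%:R.
have cP : cont_rep P.
  apply: (cont_repI TG).
    split=> [|g h]; apply/matrixP => i j; rewrite !mxE.
      have [l lP] := sP (s j); rewrite (gmulr1 HG); congr (nat_of_bool _)%:R.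
      have jl : j = l by apply/lP; rewrite (gmulV HG); case: sH.
      apply/asboolP/eqP => [/lP ->|->]; first by rewrite jl.
      by rewrite (gmulV HG); case: sH.
    have [l lP] := sP (h ** s j).
    rewrite (bigD1 l) //= big1 ?addr0 => [|m ml]; rewrite !mxE.
      have Hl : H (inv (s l) ** h ** s j) by rewrite -(gmulA HG); apply/lP.
      rewrite (asboolT Hl) mulr1.
      congr (nat_of_bool _)%:R.
      have E : inv (s i) ** (g ** h) ** s j =
          inv (s i) ** g ** s l ** (inv (s l) ** h ** s j).
        by rewrite !(gmulA HG) (gmulrK HG).
      rewrite E; apply/asboolP/asboolP => [/(HMr Hl) //|Hi].
      exact: HM.
    rewrite [X in _ * (nat_of_bool X)%:R]asboolF ?mulr0 // => Hm.
    by move/eqP: ml; apply; apply/lP; rewrite (gmulA HG).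
  apply: mx_continuous => i j g; apply: cvg_near_cst.
  by have := clopen_near (inv (s i)) (s j) g; apply: filterS => h hE; rewrite !mxE hE.
have trP g : \tr (P g) = N%:R * `[< H g >]%:R.
  rewrite /mxtrace (eq_bigr (fun=> `[< H g >]%:R)).
    by rewrite sumr_const card_ord mulr_natl.
  by move=> i _; rewrite mxE; congr (nat_of_bool _)%:R; apply/asboolP/asboolP => /HJ.
apply: (vchar_ext (vchar_scale TG (N%:R^-1) (vchar_rep cP))) => g.
(* The transversal is nonempty, so [N%:R] is invertible. *)
have [i _] := sP e.
by rewrite trP mulKf // pnatr_eq0 -lt0n (leq_trans _ (ltn_ord i)).
Qed.
End Clopen.

(** Direct sum of the family; a test matrix on one summand is extended by zero. *)
Lemma common_rep (I : eqType) (r : seq I) (k : I -> nat) (pi : forall i, G -> 'M[K]_(k i)) :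
  (forall i, cont_rep (pi i)) ->
  exists D (rho : G -> 'M[K]_D), cont_rep rho /\
    forall i B, i \in r -> exists B', forall g, \tr (B *m pi i g) = \tr (B' *m rho g).
Proof.
move=> cpi; elim: r => [|i r [D [rho [crho IH]]]].
  exists 0%N, (fun=> 1%:M); split=> //; apply: (cont_repI TG).
    by split=> // g h; rewrite mulmx1.
  exact: cst_continuous.
exists (k i + D)%N, (fun g => block_mx (pi i g) 0 0 (rho g)); split.
  exact: (block_rep TG).
move=> j; rewrite inE; case: (eqVneq j i) => [-> B _|_ B /= jr].
  exists (block_mx B 0 0 0) => g.
  by rewrite mulmx_block mxtrace_block !mul0mx !addr0 mxtrace0 addr0.
have [B' B'P] := IH j B jr; exists (block_mx 0 0 0 B') => g.
by rewrite mulmx_block mxtrace_block !mul0mx ?mulmx0 !add0r mxtrace0 add0r.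
Qed.

Section Bounded.
Variable n : nat.
Hypothesis dim_le : forall k (pi : G -> 'M[K]_k),
  cont_rep pi -> irreducible_rep pi -> (k <= n)%N.
Let N := (n * n).+1.

(** For each [t], the character of [pi] satisfies the hypothesis of [lin_comp_words] with the single
    test matrix [pi t]. As [t] varies, nondegeneracy of the trace form gives equality. *)
Lemma irreducible_lin_comp_commutes k (pi : G -> 'M[K]_k) x y :
  cont_rep pi -> irreducible_rep pi -> lin_comp e pi x -> lin_comp e pi y ->
  pi (x ** y) = pi (y ** x).
Proof.
move=> cpi irr cx cy; have hpi := cont_rep_hom cpi.
apply/eqP; rewrite -subr_eq0; apply/eqP.
apply: (irreducible_trace_nondegenerate hpi irr).
  by apply: in_spanB; apply: in_spanE.
move=> t; rewrite mxtrace_mulC.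
apply: (lin_comp_words HG hpi (N := N) (BB := [set B | B = pi t])) cx cy erefl => g _.
have [s s1 sP] := vchar_rewritable TG dim_le g t (fun=> vchar_rep cpi).
exists s => // _ ->; rewrite mxtrace_mulC mulmxBl -!(homM hpi) raddfB /=.
by apply/eqP; rewrite subr_eq0; apply/eqP.
Qed.

Hypothesis separated : forall g : G, g <> e ->
  exists (k : nat) (pi : G -> 'M[K]_k),
    [/\ cont_rep pi, irreducible_rep pi & pi g <> 1%:M].

(* The indicator of the finite-index subgroup H is a virtual character, so it can
   be used to force the quotient of the two words into H. *)
Lemma totally_rewritable (g : 'I_N -> G) :
  exists2 s, s != 1%g & word mul e g s = word mul e g 1%g.
Proof.
apply: contrapT => nrew.
pose w := word mul e g 1%g; pose a s := word mul e g s ** inv w.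
have /choice [p pP] : forall s : 'S_N, exists p : {k & G -> 'M[K]_k},
    cont_rep (projT2 p) /\ (s != 1%g ->
      irreducible_rep (projT2 p) /\ projT2 p (a s) <> 1%:M).
  move=> s; have [->|s1] := eqVneq s 1%g.
    (* A zero-dimensional representation fills the slot [s = 1%g]. *)
    exists (existT _ 0%N (fun=> 1%:M)); split=> //=; apply: (cont_repI TG).
      by split=> // x y; rewrite mulmx1.
    exact: cst_continuous.
  have ase : a s <> e.
    move=> ase; apply: nrew; exists s => //.
    by rewrite -[LHS](gmulrVK HG w) -/(a s) ase (gmul1 HG).
  by have [k [pi [cpi irr npi]]] := separated ase; exists (existT _ k pi).
pose pi s := projT2 (p s).
have cpi s : cont_rep (pi s) by have [] := pP s.
have hpi s := cont_rep_hom (cpi s).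
(* [rho] contains every [pi s], so its component lies in the component of each of them. *)
have [D [rho [crho rhoP]]] := common_rep (enum 'S_N) cpi.
have {}rhoP s B : exists B', forall x, \tr (B *m pi s x) = \tr (B' *m rho x).
  by apply: rhoP; rewrite mem_enum.
have hrho := cont_rep_hom crho.
pose H := lin_comp e rho.
have sH : is_subgroup mul inv e H by exact: lin_comp_subgroup.
have nH : is_normal mul inv H by exact: lin_comp_normal.
have iH : vchar (fun x => `[< H x >]%:R).
  apply: indicator_vchar => //; first exact: lin_comp_finite_index.
  by have [_ _ _ ?] := crho; apply: lin_closed_closed (lin_comp_lin_closed HG hrho).
have Hpi s x : H x -> lin_comp e (pi s) x.
  move=> [A [irrA Ae Ax]]; exists A; split=> // I cov.
  have /choice [F FP] := rhoP s.
  have [y Ay|_ /mapP [B BI ->] AB] := irrA [seq F B | B <- I].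
    have [B BI By] := cov y Ay; exists (F B); first exact: map_f.
    by rewrite /vanish /= -FP.
  by exists B => // y /AB; rewrite /vanish /= -FP.
(* If [a s] is outside [H], the indicator separates [a s ** h] from [h] for [h] in [H]. So rewriting
   can only select an [s] with [a s] in [H] and equal traces. *)
pose f s x : K := if `[< H (a s) >] then \tr (pi s x) else `[< H x >]%:R.
have vf s : vchar (f s).
  by rewrite /f; case: `[< H (a s) >]; [exact: (vchar_rep (cpi s))|exact: iH].
(* Irreducibility of [H] makes [s] independent of [h], as [unipotent_trivial] requires. *)
have [||s] := lin_irr_closed
  (s := [seq s <- enum 'S_N | (s != 1%g) && `[< H (a s) >]])
  (C := fun s => [set h | \tr ((pi s (a s) - 1%:M) *m pi s h) = 0])
  (lin_comp_irr HG hrho).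
- move=> s _ h /= nh; have [B BP] := rhoP s (pi s (a s) - 1%:M).
  exists B; first by rewrite /vanish /= -BP.
  by move=> x /=; rewrite /vanish /= BP.
- move=> h Hh.
  have [s s1] := vchar_rewritable TG dim_le g (inv w ** h) vf.
  rewrite (gmulVK HG) (gmulA HG) -/(a s) /f; case: asboolP => Has fE.
    exists s; first by rewrite mem_filter s1 mem_enum !andbT; apply/asboolP.
    by rewrite /= mulmxBl mul1mx -(homM (hpi s)) raddfB /= fE subrr.
  move: fE; rewrite (asboolT (P := H h)) //; case: asboolP => [Hah _|_ /eqP].
    case: Has; have [_ HM HV] := sH.
    by have := HM _ _ Hah (HV _ Hh); rewrite (gmulrK HG).
  by rewrite eq_sym oner_eq0.
- rewrite mem_filter => /andP [/andP [s1 /asboolP Has] _] sub.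
  have [_ /(_ s1) [irr]] := pP s; apply.
  apply: (unipotent_trivial HG (hpi s) irr sH nH) => // x y /Hpi cx /Hpi cy.
  exact: irreducible_lin_comp_commutes.
Qed.
End Bounded.
End Rewriting.

(** * Commutativity of the component and the double centralizer *)

Lemma mxtrace_eq0 (K : fieldType) n (X : 'M[K]_n) :
  (forall B, \tr (B *m X) = 0) -> X = 0.
Proof.
move=> tr0; apply/matrixP => i j; rewrite mxE.
have := tr0 (delta_mx j 0 *m (delta_mx 0 i : 'rV_n)).
rewrite -mulmxA mxtrace_mulC -rowE -colE /mxtrace big_ord1 !mxE.
by [].
Qed.

Lemma closed_commute (G : topologicalType) (mul : G -> G -> G) inv e y :
  hausdorff_space G -> topological_group mul inv e ->
  closed [set x | mul x y = mul y x].
Proof.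
move=> hG TG p pC; apply: hG => A B nA nB.
have cl : continuous (fun x => mul x y).
  by apply: (gmul_continuous TG); [move=> ?; exact: cvg_id|exact: cst_continuous].
have cr : continuous (fun x => mul y x).
  by apply: (gmul_continuous TG); [exact: cst_continuous|move=> ?; exact: cvg_id].
have near_p : \forall x \near p, A (mul x y) /\ B (mul y x).
  by apply: filterI; [exact: (cl p A nA)|exact: (cr p B nB)].
have [x [/= xE [Ax Bx]]] := pC _ near_p.
by exists (mul x y); split=> //; rewrite xE.
Qed.

Theorem theorem1 (R : realType) (G : topologicalType)
  (mul : G -> G -> G) (inv : G -> G) (e : G) :
  linear_lie_group mul inv e R ->
  (exists n : nat, (1 <= n)%N /\
     forall (k : nat) (pi : G -> 'M[Cplx R]_k),
       cont_rep mul e pi -> irreducible_rep pi -> (k <= n)%N) ->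
  (forall g : G, g <> e ->
     exists (k : nat) (pi : G -> 'M[Cplx R]_k),
       [/\ cont_rep mul e pi, irreducible_rep pi & pi g <> 1%:M]) ->
  exists A : set G,
    [/\ is_subgroup mul inv e A, closed A, is_commutative mul A,
        is_normal mul inv A & finite_index mul inv A].
Proof.
move=> [[hG TG _] [k [pi [cpi inj_pi]]]] [n [_ dim_le]] separated.
have HG : is_group mul inv e by case: TG.
have hpi := cont_rep_hom cpi.
pose H := lin_comp e pi.
have cH x y : H x -> H y -> mul x y = mul y x.
  move=> Hx Hy; apply: inj_pi; apply/eqP; rewrite -subr_eq0; apply/eqP.
  apply: mxtrace_eq0 => B.
  (* The words agree in G itself, so every test matrix is allowed. *)
  apply: (lin_comp_words HG hpi (N := (n * n).+1) (BB := setT)) Hx Hy _ => // g _.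
  have [s s1 sE] := totally_rewritable TG dim_le separated g.
  by exists s => // B' _; rewrite sE subrr mulmx0 mxtrace0.
have nH : is_normal mul inv H by exact: lin_comp_normal.
have centM (S : set G) : is_subgroup mul inv e [set x | forall y, S y -> mul x y = mul y x].
  split=> [y _|x x' Sx Sx' y Sy|x Sx y Sy]; first by rewrite (gmul1 HG) (gmulr1 HG).
    by rewrite -(gmulA HG) Sx' // (gmulA HG) Sx // (gmulA HG).
  by rewrite -{1}(gmulrK HG x y) -Sx // (gmulA HG) (gmulK HG) .
have centJ (S : set G) : is_normal mul inv S ->
    is_normal mul inv [set x | forall y, S y -> mul x y = mul y x].
  move=> nS g x Sx y Sy.
  have := nS (inv g) y Sy; rewrite (ginvK HG) => /Sx.
  move=> /(congr1 (fun z => mul (mul g z) (inv g))).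
  by rewrite !(gmulA HG) !(gmulrK HG) (gmulrV HG) (gmul1 HG).
(* As [H] is commutative, it lies in its centralizer [C]. So [A], which centralizes [C], also
   centralizes [H]; hence it lies in [C] and is commutative. Being a centralizer in a Hausdorff
   group, [A] is closed. *)
pose C : set G := [set y | forall x, H x -> mul y x = mul x y].
pose A : set G := [set x | forall y, C y -> mul x y = mul y x].
have HC : H `<=` C by move=> x Hx y Hy; apply: cH.
have HA : H `<=` A by move=> x Hx y Cy; rewrite Cy.
exists A; split.
- exact: centM.
- rewrite (_ : A = \bigcap_(y in C) [set x | mul x y = mul y x]).
    by apply: closed_bigI => y _; exact: closed_commute TG.
  by apply/seteqP; split=> x Ax y /Ax.
- by move=> x y Ax Ay; apply: Ax => z Hz; apply: Ay; apply: HC.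
- exact: (centJ C (centJ H nH)).
- have [N [s sP]] := lin_comp_finite_index HG hpi.
  by exists N, s => g; have [i [iN Hi]] := sP g; exists i; split=> //; apply: HA.
Qed.
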